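(* Let $\ell\ge1$ and $m\ge0$ be integers, and let $\mathbf{x}=(x_1,\dots,x_n)$, $\mathbf{y}=(y_1,\dots,y_n)$ and $\mathbf{t}=(t_1,\dots,t_{\ell-1})$ be commuting indeterminates. Then $$s_{m^\ell}(\mathbf{x},\mathbf{t},\mathbf{y})=\sum_{\lambda\subseteq m^\ell}g_\lambda(\mathbf{x};\mathbf{t})\,g_{\lambda^\dagger}(\mathbf{y};\mathbf{t}^\dagger),$$ where $\mathbf{t}^\dagger=(t_{\ell-1},\dots,t_1)$.
   Context: $m^\ell$ is the rectangular partition with $\ell$ parts equal to $m$; the sum is over all partitions $\lambda=(\lambda_1\ge\dots\ge\lambda_\ell\ge0)$ with $\lambda_1\le m$; and $\lambda^\dagger$ is the complement of $\lambda$ in the $\ell\times m$ box, $\lambda^\dagger_j=m-\lambda_{\ell+1-j}$. $s_{m^\ell}(\mathbf{x},\mathbf{t},\mathbf{y})$ is the Schur polynomial in the $2n+\ell-1$ variables $x_1,\dots,x_n,t_1,\dots,t_{\ell-1},y_1,\dots,y_n$. A reverse plane partition of shape $\lambda$ (English convention, row 1 at the top) is a filling of the boxes of $\lambda$ with positive integers that weakly increases along rows and down columns. Let $\mathrm{RPP}^n(\lambda)$ be the set of those with all entries at most $n$. For $T\in\mathrm{RPP}^n(\lambda)$, let $a_i$ be the number of columns of $T$ containing $i$, and let $b_r$ be the number of boxes in row $r$ whose entry equals the entry in the box directly below. The refined dual Grothendieck polynomial is $g_\lambda(\mathbf{x};\mathbf{t}):=\sum_{T\in\mathrm{RPP}^n(\lambda)}\prod_{r}t_r^{b_r}\prod_{i}x_i^{a_i}$,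 where $t_r$ denotes the $r$-th entry of the second argument (only the first $\ell(\lambda)-1$ entries occur). *)

(* Defs.v *)
From mathcomp Require Import all_boot all_order all_algebra.
From mathcomp Require Import mpoly.

Set Implicit Arguments.
Unset Strict Implicit.
Unset Printing Implicit Defensive.

Import GRing.Theory.
Local Open Scope ring_scope.

(* A partition is a weakly decreasing sequence of naturals, trailing zeros
   being allowed.  Rows, columns and entries are numbered from 0: the row
   [r : nat] is row r+1 of the diagram, and the entry [i : 'I_N] stands for
   the positive integer i+1 <= N. *)
Definition is_part (la : seq nat) : bool := sorted geq la.

(* For a partition, [head 0 la] is the number of columns. *)
Notation box la :=
  {b : 'I_(size la) * 'I_(head 0%N la) | (b.2 < nth 0%N la b.1)%N}.

Definition box_row la (b : box la) : 'I_(size la) := (val b).1.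
Definition box_col la (b : box la) : 'I_(head 0%N la) := (val b).2.

Definition row_weak la N (T : {ffun box la -> 'I_N}) : bool :=
  [forall b, forall b',
    (box_row b == box_row b') && (box_col b <= box_col b')%N ==> (T b <= T b')%N].

Definition col_weak la N (T : {ffun box la -> 'I_N}) : bool :=
  [forall b, forall b',
    (box_col b == box_col b') && (box_row b <= box_row b')%N ==> (T b <= T b')%N].

Definition col_strict la N (T : {ffun box la -> 'I_N}) : bool :=
  [forall b, forall b',
    (box_col b == box_col b') && (box_row b < box_row b')%N ==> (T b < T b')%N].

Definition is_ssyt la N (T : {ffun box la -> 'I_N}) : bool :=
  row_weak T && col_strict T.

Definition is_rpp la N (T : {ffun box la -> 'I_N}) : bool :=
  row_weak T && col_weak T.

Definition ncols_with la N (T : {ffun box la -> 'I_N}) (i : 'I_N) : nat :=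
  #|[set c : 'I_(head 0%N la) | [exists b, (box_col b == c) && (T b == i)]]|.

Definition nrepeats la N (T : {ffun box la -> 'I_N}) (r : nat) : nat :=
  #|[set b : box la | (box_row b == r :> nat) &&
      [exists b' : box la,
        [&& box_row b' == r.+1 :> nat, box_col b' == box_col b & T b' == T b]]]|.

Definition schur (R : comNzRingType) (la : seq nat) (N : nat)
    (x : N.-tuple R) : R :=
  \sum_(T : {ffun box la -> 'I_N} | is_ssyt T) \prod_(b : box la) tnth x (T b).

(* The exponent [nrepeats T r] vanishes when the row below is empty, so the
   default value of [t`_r] is irrelevant when [t] has at least l(la) - 1
   entries. *)
Definition dual_groth (R : comNzRingType) (la : seq nat) (N : nat)
    (x : N.-tuple R) (t : seq R) : R :=
  \sum_(T : {ffun box la -> 'I_N} | is_rpp T)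
    (\prod_(r < size la) t`_r ^+ nrepeats T r) *
    (\prod_(i < N) tnth x i ^+ ncols_with T i).

(* Complement of [la] in the (size la) x m rectangle. *)
Definition box_compl (m : nat) (la : seq nat) : seq nat :=
  rev [seq (m - k)%N | k <- la].

(* Main.v *)
(* Three facts about [g_la(x; t)] suffice.  First, the Jacobi-Trudi formula
   g_la(x; t) = det h_(la_i - i + j)(x, t_1, ..., t_(i-1)): both sides obey the
   same branching rule when a variable is added to [x], the determinant by
   expanding its rows from top to bottom modulo the row below.  In particular
   [g_la(x; t)] is symmetric in [x]; at [t = 0] it is the Schur polynomial; and
   for the rectangle row operations remove the flags, so that
   s_(m^l)(x, t, y) = g_(m^l)(x, y; t).  Secondly, cutting the reverse plane
   partitions of the rectangle between the [x]-letters and the [y]-letters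
   writes g_(m^l)(x, y; t) as a sum over [la] of [g_la(x; t)] times the
   generating function of the reverse plane partitions of shape m^l / la.
   Thirdly, rotating the latter by 180 degrees reverses [y] and [t] and gives
   [g] of the complement of [la]. *)

Require Import Defs.
From mathcomp Require Import all_boot all_order all_algebra.
From mathcomp Require Import mpoly.
From mathcomp Require Import ring zify.

Set Implicit Arguments.
Unset Strict Implicit.
Unset Printing Implicit Defensive.

Import GRing.Theory.
Local Open Scope ring_scope.

Lemma nth_cat_cons (T : Type) (d p q : T) (v w : seq T) i :
  i != size v -> nth d (v ++ p :: w) i = nth d (v ++ q :: w) i.
Proof.
move=> ne; rewrite !nth_cat; case: ltnP => // iv.
by case E: (i - size v)%N => //; move: E ne; lia.
Qed.

(** * Complete homogeneous polynomials and determinants given by lists of rows *)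

Section CompleteHomogeneous.
Variable R : comNzRingType.
Implicit Types (a b : R) (f g : nat -> R) (s : seq R).

(** On generating series, this is multiplication by 1/(1 - a z). *)
Fixpoint geom a f k : R :=
  if k is k'.+1 then f k + a * geom a f k' else f 0%N.

Lemma eq_geom a f g : f =1 g -> geom a f =1 geom a g.
Proof. by move=> fg; elim=> [|k IHk] /=; rewrite fg ?IHk. Qed.

Lemma geom_unique a f g :
  g 0%N = f 0%N -> (forall k, g k.+1 = f k.+1 + a * g k) -> g =1 geom a f.
Proof. by move=> g0 gS; elim=> [|k IHk] //=; rewrite gS IHk. Qed.

(** Both sides are f / ((1 - a z)(1 - b z)): [e] is (1 - b z) [g], and the recursion characterizing
    [geom] identifies it with [geom a f]. *)
Lemma geomC a b f : geom a (geom b f) =1 geom b (geom a f).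
Proof.
set g := geom a (geom b f).
pose e k := g k - (if k is k'.+1 then b * g k' else 0).
have ge : g =1 geom b e.
  by apply: geom_unique => [|k]; rewrite /e ?subr0 // subrK.
have ea : e =1 geom a f.
  by apply: geom_unique => [|[|k]]; rewrite /e /g /=; ring.
by move=> k; rewrite ge; apply: eq_geom.
Qed.

Lemma geom0 f : geom 0 f =1 f.
Proof. by case=> [|k] //=; rewrite mul0r addr0. Qed.

(* The degree is shifted by [d]: [hsym d s k] is the complete homogeneous
   polynomial of degree [k - d] in the variables [s], zero for [k < d]. *)
Definition hsym d s : nat -> R := foldr geom (fun k => (k == d)%:R) s.

Lemma hsym_perm d s1 s2 : perm_eq s1 s2 -> hsym d s1 =1 hsym d s2.
Proof.
have rem1 s a : a \in s -> hsym d s =1 hsym d (a :: rem a s).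
  elim: s => [//|b s IHs] /=; have [-> //|ab] := eqVneq b a.
  rewrite inE eq_sym (negPf ab) => /IHs sE k.
  by rewrite /= geomC; apply: eq_geom.
elim: s1 s2 => [|a s1 IHs] s2; first by rewrite perm_sym => /perm_nilP->.
move=> s12; have as2 : a \in s2 by rewrite -(perm_mem s12) mem_head.
move=> k; rewrite (rem1 _ _ as2); apply: eq_geom; apply: IHs.
by rewrite -(perm_cons a) (perm_trans s12) ?perm_to_rem.
Qed.

Lemma hsym_lt d s k : (k < d)%N -> hsym d s k = 0.
Proof.
elim: s k => [|a s IHs] k; first by rewrite /= ltn_neqAle => /andP[/negPf->].
elim: k => [|k IHk] /= kd; rewrite IHs //.
by rewrite -[geom _ _ _]/(hsym d (a :: s) k) IHk ?mulr0 ?addr0 // ltnW.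
Qed.

Lemma hsym_deg0 d s : hsym d s d = 1.
Proof.
elim: s => [|a s IHs]; first by rewrite /= eqxx.
case: d => [|d] in IHs *; rewrite /= ?IHs //.
by rewrite -[geom _ _ _]/(hsym d.+1 (a :: s) d) hsym_lt ?mulr0 ?addr0.
Qed.

Lemma hsym_nseq0 d i s : hsym d (nseq i 0 ++ s) =1 hsym d s.
Proof. by elim: i => [//|i IHi] k; rewrite /= geom0. Qed.

Variable l : nat.

(** Entry [j] is h_(k - l + j)(s), so k = la_i + l - i gives row i of a Jacobi-Trudi matrix; the
    shift by [l] keeps the indices natural. *)
Definition hrow s k : 'rV[R]_l := \row_j hsym l s (k + j).

Lemma hrow_perm s1 s2 k : perm_eq s1 s2 -> hrow s1 k = hrow s2 k.
Proof. by move=> s12; apply/rowP=> j; rewrite !mxE; exact: hsym_perm. Qed.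

Lemma hrow0 s : hrow s 0 = 0.
Proof. by apply/rowP=> j; rewrite !mxE add0n hsym_lt. Qed.

Lemma hrowS a s k : hrow (a :: s) k.+1 = hrow s k.+1 + a *: hrow (a :: s) k.
Proof. by apply/rowP=> j; rewrite !mxE. Qed.

Lemma hrow_cons a s k :
  hrow (a :: s) k = \sum_(c < k.+1) a ^+ (k - c) *: hrow s c.
Proof.
elim: k => [|k IHk]; first by rewrite big_ord1 !hrow0 scaler0.
rewrite hrowS IHk [RHS]big_ord_recr /= subnn scale1r addrC; congr (_ + _).
rewrite scaler_sumr; apply: eq_bigr => c _.
by rewrite scalerA -exprS subSn // -ltnS.
Qed.

(* The last summand is a multiple of the row placed just below, hence
   invisible in the determinant. *)
Lemma hrow_expand a u s k n : (k < n)%N ->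
  hrow (a :: s) n =
  \sum_(c < n.+1) (a ^+ (n - maxn k.+1 c) * u ^+ (k.+1 - c)) *: hrow s c
  + (a ^+ (n - k.+1) * (a - u)) *: hrow (u :: a :: s) k.
Proof.
elim: n => [//|n IHn]; rewrite ltnS leq_eqVlt => /predU1P[<-{n IHn}|kn].
  rewrite (subnn k.+1) mul1r.
  rewrite (eq_bigr (fun c : 'I_k.+2 => u ^+ (k.+1 - c) *: hrow s c)); last first.
    by move=> c _; rewrite (maxn_idPl (ltn_ord c : (c <= k.+1)%N)) (subnn k.+1) mul1r.
  rewrite -hrow_cons scalerBl addrA.
  (* Splitting off [u] or [a] from h_(k+1)(u, a, s) gives h_(k+1)(a, s) - h_(k+1)(u, s) = (a - u)
     h_k(u, a, s). *)
  have auC i : hrow (u :: a :: s) i = hrow (a :: u :: s) i.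
    by apply: hrow_perm; rewrite -[_ :: _]/([:: u] ++ [:: a] ++ s) perm_catCA.
  by rewrite {1}auC -hrowS -auC (hrowS u (a :: s)) addrK.
rewrite hrowS (IHn kn) scalerDr [in RHS]big_ord_recr /= addrA.
have -> : (maxn k.+1 n.+1 = n.+1)%N by apply/maxn_idPr; rewrite ltnW.
rewrite subnn (eqP (_ : k.+1 - n.+1 == 0)%N) ?subn_eq0 1?ltnW //.
rewrite !expr0 mul1r scale1r [hrow s _ + _]addrC; congr (_ + _ + _).
  rewrite scaler_sumr; apply: eq_bigr => c _; rewrite scalerA mulrA -exprS.
  have cn : (maxn k.+1 c <= n)%N by rewrite geq_max kn -ltnS ltn_ord.
  by rewrite (subSn cn).
by rewrite scalerA mulrA -exprS (subSn kn).
Qed.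

(** The value 0 for a wrong number of rows frees the multilinearity laws from length hypotheses. *)
Definition rowdet (v : seq 'rV[R]_l) : R :=
  if size v == l then \det (\matrix_(i < l) nth 0 v i) else 0.

Lemma rowdet_linear v w a (p q : 'rV[R]_l) :
  rowdet (v ++ (a *: p + q) :: w) =
  a * rowdet (v ++ p :: w) + rowdet (v ++ q :: w).
Proof.
rewrite /rowdet !size_cat /=; case: eqP => [sz|_]; last by rewrite mulr0 addr0.
have vl : (size v < l)%N by rewrite -[X in (_ < X)%N]sz !addnS ltnS leq_addr.
rewrite -[X in _ = _ + X]mul1r.
apply: (determinant_multilinear (i0 := Ordinal vl)).
- by apply/rowP=> j; rewrite !mxE !nth_cat ltnn subnn /= !mxE mul1r.
- by apply/matrixP=> i j; rewrite !mxE (nth_cat_cons _ p (a *: p + q)) // eq_sym neq_lift.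
- by apply/matrixP=> i j; rewrite !mxE (nth_cat_cons _ q (a *: p + q)) // eq_sym neq_lift.
Qed.

Lemma rowdet_alternate v w (p : 'rV[R]_l) : rowdet (v ++ p :: p :: w) = 0.
Proof.
rewrite /rowdet size_cat /=; case: eqP => [sz|//].
have vl1 : ((size v).+1 < l)%N by rewrite -[X in (_ < X)%N]sz !addnS ltnS ltnS leq_addr.
have vl := ltnW vl1.
apply: (determinant_alternate (i1 := Ordinal vl) (i2 := Ordinal vl1)).
  by rewrite -val_eqE /= neq_ltn ltnSn.
by move=> j; rewrite !mxE !nth_cat ltnn subnn ltnNge leqnSn /= subSnn.
Qed.

Lemma rowdet_zero v w : rowdet (v ++ 0 :: w) = 0.
Proof.
have := rowdet_linear v w (-1) 0 0.
by rewrite scaler0 addr0 mulN1r addNr.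
Qed.

Lemma rowdet_sum v w (I : Type) (r : seq I) (P : pred I) (a : I -> R)
    (p : I -> 'rV[R]_l) :
  rowdet (v ++ (\sum_(i <- r | P i) a i *: p i) :: w) =
  \sum_(i <- r | P i) a i * rowdet (v ++ p i :: w).
Proof.
elim: r => [|i r IHr]; first by rewrite !big_nil rowdet_zero.
by rewrite !big_cons; case: (P i) => //; rewrite rowdet_linear IHr.
Qed.

End CompleteHomogeneous.

Lemma big_tuple_cons (V : nmodType) (T : finType) k
    (P : pred (seq T)) (F : seq T -> V) :
  \sum_(s : k.+1.-tuple T | P s) F s =
  \sum_(c : T) \sum_(s : k.-tuple T | P (c :: s)) F (c :: s).
Proof.
rewrite pair_big_dep /=.
rewrite (reindex (fun p : T * k.-tuple T => cons_tuple p.1 p.2)) //=.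
exists (fun s => (thead s, behead_tuple s)) => [[c s] _|s _] /=.
  by congr pair; apply: val_inj.
by rewrite [RHS]tuple_eta; apply: val_inj.
Qed.

Lemma path_geqE c la : path geq c la = (head 0%N la <= c)%N && is_part la.
Proof. by case: la. Qed.

Lemma head_all2 mu la : all2 leq mu la -> (head 0 mu <= head 0 la)%N.
Proof. by case: mu la => [|c mu] [|p la] //= /andP[]. Qed.

Notation natseq s := [seq nat_of_ord k | k <- s].

(** * Branching rule for flagged Jacobi-Trudi determinants *)

Section Branching.
Variables (R : comNzRingType) (t : seq R).
Implicit Types (a : R) (x : seq R) (la mu : seq nat).

(** The order is reversed so that the next row gets its new variable in front; beyond the end of [t]
    the variables are 0 and leave h unchanged. *)
Definition flag x i : seq R := rev (mkseq (nth 0 t) i) ++ x.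

Lemma flagS x i : flag x i.+1 = t`_i :: flag x i.
Proof. by rewrite /flag mkseqS rev_rcons. Qed.

Lemma perm_flag x1 x2 i : perm_eq x1 x2 -> perm_eq (flag x1 i) (flag x2 i).
Proof. by move=> xx; rewrite perm_cat2l. Qed.

Lemma perm_flag_cons a x i : perm_eq (flag (a :: x) i) (a :: flag x i).
Proof. by rewrite /flag -cat1s perm_catCA. Qed.

(** For p = la_i, q = la_(i+1), c = mu_i with mu inside la: row i of la / mu gives a factor [a] for
    each box with no box of la below it, and [u] for each other box. *)
Definition bfactor a u p q c : R := a ^+ (p - maxn q c) * u ^+ (q - c).

Definition branch_weight a r la mu : R :=
  \prod_(i < size la)
    bfactor a t`_(r + i) (nth 0%N la i) (nth 0%N la i.+1) (nth 0%N mu i).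

Lemma branch_weight_cons a r p la c mu :
  branch_weight a r (p :: la) (c :: mu) =
  bfactor a t`_r p (head 0%N la) c * branch_weight a r.+1 la mu.
Proof.
rewrite /branch_weight big_ord_recl /= addn0 nth0; congr (_ * _).
by apply: eq_bigr => i _; rewrite /= addSnnS.
Qed.

Variables l m : nat.

Fixpoint jt_rows x r la : seq 'rV[R]_l :=
  if la is c :: la' then hrow l (flag x r) (c + size la) :: jt_rows x r.+1 la'
  else [::].

(** The row below has the variables of this one and t_r, so in [hrow_expand] with u = t_r the last
    summand is a multiple of it and drops out. With no row below, the term c = 0 vanishes by
    [hrow0]. *)
Lemma rowdet_expand_head v a x r p la : (head 0%N la <= p)%N ->
  rowdet (v ++ jt_rows (a :: x) r (p :: la)) =
  \sum_(c < (p + (size la).+1).+1)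
     bfactor a t`_r (p + (size la).+1) (head 0%N la + size la).+1 c *
     rowdet (v ++ hrow l (flag x r) c :: jt_rows (a :: x) r.+1 la).
Proof.
move=> hp; rewrite /= (hrow_perm _ _ (perm_flag_cons a x r)).
case: la hp => [_|q la hp] /=.
  rewrite hrow_cons rowdet_sum !big_ord_recl /= hrow0 !rowdet_zero !mulr0 !add0r.
  apply: eq_bigr => i _.
  by rewrite /bfactor /bump leq0n add1n maxnSS max0n [(_.+1 - i.+1)%N]subSS sub0n mulr1.
rewrite (@hrow_expand _ _ a t`_r _ (q + (size la).+1)%N); last first.
  by rewrite [X in (_ < X)%N]addnS ltnS leq_add2r.
set S := \sum_(c < _) _; set w := hrow _ (t`_r :: _) _.
have -> : hrow l (flag (a :: x) r.+1) (q + (size la).+1) = w.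
  by apply: hrow_perm; rewrite flagS perm_cons perm_flag_cons.
by rewrite addrC rowdet_linear rowdet_alternate mulr0 add0r rowdet_sum.
Qed.

(** Here [mu] is the tail, already expanded, and [e] its first part. The terms with c <= e + k add
    up to a multiple of the row below and vanish; the others, lowered by k + 1, are the new first
    parts c with e <= c <= p. *)
Lemma rowdet_trim v a x r p q mu k :
  (head 0%N mu <= q <= p)%N -> (p <= m)%N -> size mu = k ->
  \sum_(c < (p + k.+1).+1)
     bfactor a t`_r (p + k.+1) (q + k).+1 c *
     rowdet (v ++ hrow l (flag x r) c :: jt_rows x r.+1 mu) =
  \sum_(c < m.+1 | (head 0%N mu <= c <= p)%N)
     bfactor a t`_r p q c * rowdet (v ++ jt_rows x r (nat_of_ord c :: mu)).
Proof.
move=> /andP[eq qp] pm <-{k}; set e := head 0%N mu; set k := size mu.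
pose F c := bfactor a t`_r (p + k.+1) (q + k).+1 c *
     rowdet (v ++ hrow l (flag x r) c :: jt_rows x r.+1 mu).
rewrite -(big_mkord xpredT F) (big_cat_nat (n := (e + k).+1)) //=; last first.
  by rewrite -/e in eq; lia.
rewrite [X in X + _]big_mkord [X in X + _](_ : _ = 0) ?add0r; last first.
  rewrite {}/F {}/k {}/e; case: mu eq => [|f mu] /= eq.
    by rewrite big_ord1 /= hrow0 rowdet_zero mulr0.
  set k := (size mu).+1; set W := jt_rows _ _ mu.
  (* Since c <= f + k <= q + k, the exponent of [a] is constant; a power of t_r also factors out and
     leaves the expansion of the row below. *)
  transitivity (\sum_(c < (f + k).+1) a ^+ (p + k.+1 - (q + k).+1) *
      t`_r ^+ (q.+1 - f) * (t`_r ^+ (f + k - c) *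
      rowdet (v ++ hrow l (flag x r) c :: hrow l (flag x r.+1) (f + k) :: W))).
    apply: eq_bigr => c _; have cfk := ltn_ord c; rewrite [RHS]mulrA /bfactor.
    rewrite -[a ^+ _ * _ * t`_r ^+ _]mulrA -exprD (maxn_idPl _); last by lia.
    by congr (_ * _ ^+ _ * _); lia.
  rewrite -mulr_sumr -rowdet_sum -(hrow_cons l t`_r (flag x r)) -flagS.
  by rewrite rowdet_alternate mulr0.
rewrite -[(e + k).+1]addnS -[(p + k.+1).+1]/(p.+1 + k.+1)%N big_addn addnK.
rewrite (big_nat_widen _ _ m.+1) ?ltnS // big_geq_mkord.
apply: eq_big => [c|c /andP[/= cp ec]]; first by rewrite /= ltnS andbC.
rewrite /F /bfactor /= -/k; congr (_ ^+ _ * _ ^+ _ * _); lia.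
Qed.

(** The head is expanded first, while the row below still contains [a]; it then joins the prefix [v]
    during the expansion of the tail, and only afterwards does [rowdet_trim] cut its range down to
    partitions. *)
Lemma rowdet_branch v a x r la : is_part la -> all (leq^~ m) la ->
  rowdet (v ++ jt_rows (a :: x) r la) =
  \sum_(mu : (size la).-tuple 'I_m.+1
           | is_part (natseq mu) && all2 leq (natseq mu) la)
     branch_weight a r la (natseq mu) * rowdet (v ++ jt_rows x r (natseq mu)).
Proof.
elim: la v r => [|p la IHla] v r.
  move=> _ _; rewrite (big_pred1 [tuple]) /=.
    by rewrite /branch_weight big_ord0 mul1r.
  by move=> mu; rewrite tuple0; apply: esym; apply/eqP; apply: val_inj.
rewrite {1}/is_part /= path_geqE => /andP[hp pla] /andP[pm alla].
rewrite (rowdet_expand_head v a x r hp).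
have IH c : rowdet (v ++ hrow l (flag x r) c :: jt_rows (a :: x) r.+1 la) =
  \sum_(mu : (size la).-tuple 'I_m.+1 | is_part (natseq mu) && all2 leq (natseq mu) la)
     branch_weight a r.+1 la (natseq mu) *
     rowdet (v ++ hrow l (flag x r) c :: jt_rows x r.+1 (natseq mu)).
  by rewrite -cat_rcons IHla //; apply: eq_bigr => mu _; rewrite cat_rcons.
under [LHS]eq_bigr => c _ do rewrite IH mulr_sumr.
rewrite [LHS]exchange_big /=.
rewrite (big_tuple_cons (size la) (fun s => is_part (natseq s) && all2 leq (natseq s) (p :: la))
  (fun s => branch_weight a r (p :: la) (natseq s) * rowdet (v ++ jt_rows x r (natseq s)))) /=.
rewrite [RHS](exchange_big_dep (fun mu : (size la).-tuple 'I_m.+1 =>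
   is_part (natseq mu) && all2 leq (natseq mu) la)) /=; last first.
  by move=> c mu _; rewrite path_geqE -andbA => /and4P[_ -> _ ->].
apply: eq_bigr => mu /andP[pmu mula].
have smu : size (natseq mu) = size la by rewrite size_map size_tuple.
rewrite (eq_bigr (fun c : 'I__ => branch_weight a r.+1 la (natseq mu) *
  (bfactor a t`_r (p + (size la).+1) (head 0%N la + size la).+1 c *
   rowdet (v ++ hrow l (flag x r) c :: jt_rows x r.+1 (natseq mu))))); last first.
  by move=> c _; rewrite mulrCA.
rewrite -mulr_sumr rowdet_trim //; last first.
  by rewrite hp andbT head_all2.
rewrite mulr_sumr; apply: eq_big => [c|c _].
  by rewrite path_geqE pmu mula !andbT.
by rewrite branch_weight_cons mulrCA mulrA.
Qed.

End Branching.

(** * Fillings as functions on the quadrant *)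

Lemma part_nth la i j : is_part la -> (i <= j)%N -> (nth 0 la j <= nth 0 la i)%N.
Proof.
move=> pla ij; case: (ltnP j (size la)) => [jl|jl]; last by rewrite nth_default.
have geq_trans : transitive geq by move=> ? ? ? /[swap]; apply: leq_trans.
by apply: (sorted_leq_nth geq_trans leqnn 0%N pla) => //; rewrite inE (leq_ltn_trans ij).
Qed.

Lemma part_head la i : is_part la -> (nth 0 la i <= head 0 la)%N.
Proof. by move=> pla; rewrite -nth0 part_nth. Qed.

Section Boxes.
Variables (la : seq nat) (pla : is_part la).

Lemma box_in (b : box la) : (box_col b < nth 0 la (box_row b))%N.
Proof. exact: (valP b). Qed.

Lemma box_inj (b b' : box la) : box_row b = box_row b' :> nat ->
  box_col b = box_col b' :> nat -> b = b'.
Proof.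
case: b b' => [[r c] h] [[r' c'] h'] /= rr cc; apply: val_inj => /=.
by congr pair; apply: val_inj.
Qed.

Lemma box_exists r c : (c < nth 0 la r)%N ->
  exists b : box la, box_row b = r :> nat /\ box_col b = c :> nat.
Proof.
move=> cr; have rl : (r < size la)%N by case: (ltnP r) cr => // rl; rewrite nth_default.
have cl := leq_trans cr (part_head r pla).
by exists (exist _ (Ordinal rl, Ordinal cl) cr).
Qed.

Variable N : nat.
Implicit Type T : {ffun box la -> 'I_N}.

(* Outside the diagram the entry is [N], larger than all actual entries; a
   reverse plane partition is then weakly increasing on the whole quadrant. *)
Definition entry T r c : nat :=
  if [pick b : box la | (box_row b == r :> nat) && (box_col b == c :> nat)]
    is Some b then T b else N.

Lemma entry_box T b : entry T (box_row b) (box_col b) = T b.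
Proof.
rewrite /entry; case: pickP => [b' /andP[/eqP rr /eqP cc]|/(_ b)].
  by rewrite (box_inj rr cc).
by rewrite !eqxx.
Qed.

Lemma entry_lt T r c : (entry T r c < N)%N = (c < nth 0 la r)%N.
Proof.
rewrite /entry; case: pickP => [b /andP[/eqP<- /eqP<-]|nb].
  by rewrite ltn_ord box_in.
rewrite ltnn; apply/esym/negP => /box_exists[b [rb cb]].
by have := nb b; rewrite rb cb !eqxx.
Qed.

Lemma entry_out T r c : (nth 0 la r <= c)%N -> entry T r c = N.
Proof.
rewrite /entry; case: pickP => [b /andP[/eqP<- /eqP<-]|//].
by rewrite leqNgt box_in.
Qed.

Lemma entry_le T r c : (entry T r c <= N)%N.
Proof.
by case: (ltnP c (nth 0%N la r)) => [|/(entry_out T)-> //]; rewrite -(entry_lt T) => /ltnW.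
Qed.

Lemma eq_entry T T' : entry T =2 entry T' -> T = T'.
Proof.
by move=> TT; apply/ffunP=> b; apply: val_inj; rewrite /= -!entry_box TT.
Qed.

Lemma is_rppP T :
  reflect ((forall r c c', (c <= c')%N -> (entry T r c <= entry T r c')%N) /\
           (forall r r' c, (r <= r')%N -> (entry T r c <= entry T r' c)%N))
          (is_rpp T).
Proof.
apply: (iffP andP) => [[row col]|[row col]]; split.
- move=> r c c' cc; case: (ltnP c' (nth 0%N la r)) => c'r; last first.
    by rewrite (entry_out _ c'r) entry_le.
  have [b [rb cb]] := box_exists (leq_ltn_trans cc c'r).
  have [b' [rb' cb']] := box_exists c'r.
  rewrite -{1}rb -{1}rb' -cb -cb' !entry_box.
  apply: (implyP (forallP (forallP row b) b')).
  by rewrite -val_eqE /= rb rb' cb cb' eqxx.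
- move=> r r' c rr; case: (ltnP c (nth 0%N la r')) => cr'; last first.
    by rewrite (entry_out _ cr') entry_le.
  have [b [rb cb]] := box_exists (leq_trans cr' (part_nth pla rr)).
  have [b' [rb' cb']] := box_exists cr'.
  rewrite -{1}rb -rb' -{1}cb -cb' !entry_box.
  apply: (implyP (forallP (forallP col b) b')).
  by rewrite -val_eqE /= rb rb' cb cb' eqxx.
- apply/forallP => b; apply/forallP => b'; apply/implyP => /andP[/eqP rr cc].
  by rewrite -!entry_box rr row.
- apply/forallP => b; apply/forallP => b'; apply/implyP => /andP[/eqP cc rr].
  by rewrite -!entry_box cc col.
Qed.

Variables (m : nat) (lam : (head 0 la <= m)%N).

(** A repeat is determined by its column; the bound by la_(r+1) excludes the columns where both
    entries are the default [N]. Columns lie in a common ['I_m] so that different shapes can be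
    compared. *)
Lemma nrepeatsE T r : nrepeats T r =
  #|[set c : 'I_m | (c < nth 0 la r.+1)%N && (entry T r c == entry T r.+1 c)]|.
Proof.
rewrite /nrepeats; pose f (b : box la) := widen_ord lam (box_col b).
rewrite -(card_in_imset (f := f)); last first.
  move=> b b'; rewrite !inE => /andP[/eqP rb _] /andP[/eqP rb' _] /(congr1 val) /= cc.
  by apply: box_inj => //; rewrite rb rb'.
apply: eq_card => c; rewrite inE; apply/imsetP/andP => [[b]|[cr /eqP ee]].
  rewrite inE => /andP[/eqP rb /existsP[b' /and3P[/eqP rb' /eqP cb' /eqP TT]]] -> /=.
  by rewrite -rb' -{1 3}cb' box_in -rb !entry_box TT.
have [b' [rb' cb']] := box_exists cr.
have [b [rb cb]] := box_exists (leq_trans cr (part_nth pla (leqnSn r))).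
exists b; last by apply: val_inj; rewrite /= cb.
rewrite inE rb eqxx; apply/existsP; exists b'; rewrite rb' eqxx -!val_eqE /= cb cb' eqxx.
by rewrite -!entry_box rb rb' cb cb' ee eqxx.
Qed.

Lemma ncols_withE T i : ncols_with T i =
  #|[set c : 'I_m | has (fun r => entry T r c == i) (iota 0 (size la))]|.
Proof.
rewrite /ncols_with -(card_imset _ (f := widen_ord lam)); last first.
  by move=> c c' /(congr1 val) cc; apply: val_inj.
apply: eq_card => c; rewrite inE; apply/imsetP/hasP => [[c']|[r _ /eqP er]].
  rewrite inE => /existsP[b /andP[/eqP<- /eqP Ti]] ->.
  by exists (val (box_row b)); rewrite ?mem_iota /= ?entry_box ?Ti.
have cr : (c < nth 0 la r)%N by rewrite -(entry_lt T) er.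
have [b [rb cb]] := box_exists cr.
exists (box_col b); last by apply: val_inj; rewrite /= cb.
by rewrite inE; apply/existsP; exists b; rewrite eqxx -val_eqE /= -entry_box rb cb er /=.
Qed.

End Boxes.

Lemma card_interval m p q : (q <= m)%N ->
  #|[set c : 'I_m | (p <= c < q)%N]| = (q - p)%N.
Proof.
move=> qm; rewrite cardsE -sum1_card -[RHS]muln1 -sum_nat_const_nat.
rewrite (big_nat_widen _ _ m) // big_geq_mkord; apply: eq_bigl => c.
by rewrite /= andbC.
Qed.

Lemma initial_segment m (P : pred nat) :
  (forall c c', (c <= c')%N -> P c' -> P c) -> (forall c, P c -> (c < m)%N) ->
  forall c, P c = (c < #|[set c : 'I_m | P c]|)%N.
Proof.
move=> Pdown Pm c; have exNP : exists k, ~~ P k.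
  by exists m; apply/negP => /Pm; rewrite ltnn.
case: (ex_minnP exNP) => k nPk kmin.
have PE i : P i = (i < k)%N.
  case: ltnP => [ik|ki]; last by apply/negP => /(Pdown _ _ ki); apply/negP.
  by apply: contraLR ik => nPi; rewrite -leqNgt kmin.
have km : (k <= m)%N by apply: kmin; apply/negP => /Pm; rewrite ltnn.
rewrite PE -[k in LHS]subn0 -(card_interval 0 km).
by congr (_ < _)%N; apply: eq_card => i; rewrite !inE PE.
Qed.

Lemma eq_ltn_inj p q : (forall c, (c < p)%N = (c < q)%N) -> p = q.
Proof.
by move=> pq; case: (ltngtP p q) => // [|]; rewrite ?pq ?ltnn // -pq ltnn.
Qed.

Lemma all2_leq_nth mu la : size mu = size la ->
  (forall r, (nth 0 mu r <= nth 0 la r)%N) -> all2 leq mu la.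
Proof.
elim: mu la => [|c mu IHmu] [|p la] //= [smu] le.
by rewrite (le 0%N) IHmu // => r; apply: (le r.+1).
Qed.

(* Each column meeting [la / mu] is counted in its lowest box, which lies in
   the unique row [r] with [la_(r+1) <= c < la_r]. *)
Lemma has_strip la mu c : is_part la -> is_part mu -> all2 leq mu la ->
  has (fun r => nth 0 mu r <= c < nth 0 la r)%N (iota 0 (size la)) =
  (\sum_(r < size la) (maxn (nth 0 la r.+1) (nth 0 mu r) <= c < nth 0 la r))%N
  :> nat.
Proof.
elim: la mu => [|p la IHla] [|q mu]; rewrite ?big_ord0 //=.
rewrite /is_part /= !path_geqE => /andP[hp pla] /andP[hq pmu] /andP[qp mula].
rewrite big_ord_recl /= -[1%N]addn0 iotaDl has_map.
set h := has _ _.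
have hE : h = has (fun r => nth 0 mu r <= c < nth 0 la r)%N (iota 0 (size la)).
  by apply: eq_has => r.
(* If [c] is less than [head 0 la], the first row adds nothing: a box of la / mu there has another
   one below it, as the parts of [mu] decrease. Otherwise no later row reaches column [c]. *)
rewrite -IHla // -hE geq_max nth0; case: (ltnP c (head 0%N la)) => [cl|lc] /=.
  case: andP => // -[qc cp]; suff -> : h by [].
  rewrite hE; case: (la) (mu) cl hq qp mula => [|u la'] [|v mu'] //= cl hq _ _.
  by rewrite cl (leq_trans hq qc).
suff -> : h = false by rewrite orbF addn0.
rewrite hE; apply/hasP => -[r _ /andP[_]].
by rewrite ltnNge (leq_trans (part_head r pla)).
Qed.

(** * Removing the largest letter from a reverse plane partition *)

Section Peel.
Variables (la mu : seq nat) (N : nat).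
Hypotheses (pla : is_part la) (pmu : is_part mu) (mula : all2 leq mu la).

Lemma sub_size : size mu = size la.
Proof. by move: mula; rewrite all2E => /andP[/eqP]. Qed.

Lemma sub_nth r : (nth 0 mu r <= nth 0 la r)%N.
Proof.
elim: mu la r mula => [|c s IHs] [|p s'] [|r] //= /andP[cp ss] //.
exact: IHs.
Qed.

(** As [entry T] is [N] outside [mu], reading it on the boxes of [la] writes the new largest letter
    [N] on la / mu. *)
Definition extend (T : {ffun box mu -> 'I_N}) : {ffun box la -> 'I_N.+1} :=
  [ffun b => inord (entry T (box_row b) (box_col b))].

Lemma entry_extend T r c :
  entry (extend T) r c = if (c < nth 0 la r)%N then entry T r c else N.+1.
Proof.
case: ltnP => [cr|/entry_out->//].
have [b [<- <-]] := box_exists pla cr.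
by rewrite entry_box ffunE inordK // ltnS entry_le.
Qed.

Lemma entry_extend_min T r c : entry T r c = minn (entry (extend T) r c) N.
Proof.
rewrite entry_extend; case: ltnP => [_|cr].
  by rewrite (minn_idPl _) // entry_le.
by rewrite (minn_idPr _) // entry_out // (leq_trans (sub_nth r)).
Qed.

Lemma extend_inj : injective extend.
Proof. by move=> T T' ee; apply: eq_entry => r c; rewrite !entry_extend_min ee. Qed.

(** The condition makes [mu] the region of the letters below [N]; capping the entries at [N] then
    gives the preimage. *)
Lemma extend_image (T : {ffun box la -> 'I_N.+1}) :
  (is_rpp T /\ forall r c, (entry T r c < N)%N = (c < nth 0 mu r)%N) <->
  (exists2 T', is_rpp T' & T = extend T').
Proof.
split=> [[rT shT]|[T' rT' ->]]; last first.
  have [row col] := is_rppP pmu T' rT'.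
  split=> [|r c]; last first.
    rewrite entry_extend; case: (ltnP c (nth 0%N la r)) => [_|cr]; first by rewrite entry_lt.
    by rewrite ltnNge leqnSn ltnNge (leq_trans (sub_nth r)).
  apply/(is_rppP pla); split=> [r c c' cc|r r' c rr]; rewrite !entry_extend.
    case: (ltnP c' _) => [c'r|_]; first by rewrite (leq_ltn_trans cc c'r) row.
    by case: ifP => // _; rewrite (leq_trans (entry_le pmu _ _ _)).
  case: (ltnP c (nth 0%N la r')) => [c'r|_].
    by rewrite (leq_trans c'r (part_nth pla rr)) col.
  by case: ifP => // _; rewrite (leq_trans (entry_le pmu _ _ _)).
have /fin_all_exists[T' T'E] (b : box mu) :
    exists i : 'I_N, i = entry T (box_row b) (box_col b) :> nat.
  have lt : (entry T (box_row b) (box_col b) < N)%N by rewrite shT box_in.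
  by exists (Ordinal lt).
have eT r c : entry (finfun T') r c = minn (entry T r c) N.
  case: (ltnP c (nth 0%N mu r)) => cr.
    have [b [rb cb]] := box_exists pmu cr.
    by rewrite -rb -cb entry_box ffunE T'E (minn_idPl _) // ltnW // shT rb cb.
  by rewrite entry_out // (minn_idPr _) // leqNgt shT -leqNgt.
have [row col] := is_rppP pla T rT.
exists (finfun T').
  apply/(is_rppP pmu); split=> [r c c' cc|r r' c rr]; rewrite !eT.
    by rewrite leq_min geq_minr andbT geq_min row.
  by rewrite leq_min geq_minr andbT geq_min col.
apply: eq_entry => r c; rewrite entry_extend eT.
case: ltnP => cr; last by rewrite entry_out.
by rewrite (minn_idPl _) // -ltnS entry_lt.
Qed.

Variables (m : nat) (lam : (head 0 la <= m)%N).

Let mum : (head 0 mu <= m)%N := leq_trans (head_all2 mula) lam.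

(** A new repeat has the letter [N] in both boxes, so its column runs from mu_r up to la_(r+1);
    truncated subtraction covers an empty range. *)
Lemma nrepeats_extend T r :
  nrepeats (extend T) r = (nrepeats T r + (nth 0 la r.+1 - nth 0 mu r))%N.
Proof.
rewrite (nrepeatsE pla lam) (nrepeatsE pmu mum).
set A := [set c | _]; set B := [set c | _].
rewrite -(cardsID B A) -(@card_interval m); last first.
  by rewrite (leq_trans (part_head _ pla)).
congr (_ + _)%N; apply: eq_card => c; rewrite !inE !entry_extend.
  case: (ltnP c (nth 0%N mu r.+1)) => [cm|//]; last by rewrite andbF.
  have cl := leq_trans cm (sub_nth r.+1).
  by rewrite cl (leq_trans cl (part_nth pla (leqnSn r))) andbb.
case: (ltnP c (nth 0%N la r.+1)) => [cl|]; last by rewrite !andbF.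
rewrite (leq_trans cl (part_nth pla (leqnSn r))) andbT.
case: (ltnP c (nth 0%N mu r.+1)) => [cm|cm] /=.
  by rewrite andNb leqNgt (leq_trans cm (part_nth pmu (leqnSn r))).
by rewrite (entry_out _ cm) eqn_leq (entry_le pmu) leqNgt entry_lt // -leqNgt.
Qed.

Lemma ncols_extend_lt T i :
  ncols_with (extend T) (widen_ord (leqnSn N) i) = ncols_with T i.
Proof.
rewrite (ncols_withE pla lam) (ncols_withE pmu mum) sub_size.
apply: eq_card => c; rewrite !inE; apply: eq_has => r /=.
by rewrite entry_extend_min; have := ltn_ord i; lia.
Qed.

(** A column contains the letter [N] exactly when it meets la / mu; [has_strip] counts it in the row
    of its lowest box. *)
Lemma ncols_extend_max T : ncols_with (extend T) ord_max =
  (\sum_(r < size la) (nth 0 la r - maxn (nth 0 la r.+1) (nth 0 mu r)))%N.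
Proof.
rewrite (ncols_withE pla lam) cardsE -sum1_card big_mkcond /=.
under [RHS]eq_bigr => r _.
  rewrite -(@card_interval m); last by rewrite (leq_trans (part_head _ pla)).
  rewrite cardsE -sum1_card big_mkcond /=; over.
rewrite exchange_big /=; apply: eq_bigr => c _.
transitivity (nat_of_bool
    (has (fun r => nth 0 mu r <= c < nth 0 la r)%N (iota 0 (size la)))).
  rewrite unfold_in; set b := has _ _; set b' := has _ _; suff -> : b = b' by case: b'.
  apply: eq_has => r; rewrite /= entry_extend; case: (ltnP c (nth 0%N la r)) => cl.
    by rewrite eqn_leq (entry_le pmu) /= leqNgt entry_lt // -leqNgt andbT.
  by rewrite andbF eqn_leq ltnn.
by rewrite has_strip //; apply: eq_bigr => r _; rewrite unfold_in.
Qed.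

End Peel.

(** Fillings are sorted by the shape [mu] of their letters other than the last; those of one shape
    are the extensions of the fillings of [mu]. *)
Lemma dual_groth_rcons (R : comNzRingType) (t : seq R) (la : seq nat) (l m N : nat)
    (x : N.-tuple R) (a : R) :
  is_part la -> all (leq^~ m) la -> size la = l ->
  dual_groth la [tuple of rcons x a] t =
  \sum_(mu : l.-tuple 'I_m.+1
          | is_part (natseq mu) && all2 leq (natseq mu) la)
    branch_weight t a 0 la (natseq mu) * dual_groth (natseq mu) x t.
Proof.
move=> pla alla <-.
have lam : (head 0 la <= m)%N by case: (la) alla => //= p s /andP[].
have lem r : (nth 0 la r <= m)%N := leq_trans (part_head r pla) lam.
(* In a reverse plane partition the entries below [N] form an initial segment of each row, of length
   at most [m], so [inord] does not alter the count. *)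
pose sh (T : {ffun box la -> 'I_N.+1}) : (size la).-tuple 'I_m.+1 :=
  [tuple inord #|[set c : 'I_m | (entry T r c < N)%N]| | r < size la].
have nth_tuple (f : 'I_(size la) -> 'I_m.+1) (r : 'I_(size la)) :
    nth 0%N (natseq [tuple f i | i < size la]) r = f r.
  by rewrite (nth_map ord0) ?size_tuple // -tnth_nth tnth_mktuple.
have entry_sh T r c : is_rpp T ->
    (entry T r c < N)%N = (c < nth 0 (natseq (sh T)) r)%N.
  case/(is_rppP pla) => row _; case: (ltnP r (size la)) => rl.
    rewrite (nth_tuple _ (Ordinal rl)) /= inordK; last first.
      by rewrite ltnS (leq_trans (max_card _)) ?card_ord.
    apply: (initial_segment (m := m) (P := fun c => (entry T r c < N)%N)) => {}c.
      by move=> c' cc; apply/leq_ltn_trans/row.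
    by move=> cN; rewrite (leq_trans _ (lem r)) // -(entry_lt pla T) ltnW.
  have -> : nth 0%N (natseq (sh T)) r = 0%N.
    by rewrite nth_default // size_map size_tuple.
  by rewrite entry_out ?nth_default // ltnNge leqnSn.
have shP T (mu : (size la).-tuple 'I_m.+1) : is_rpp T -> reflect
    (forall r c, (entry T r c < N)%N = (c < nth 0 (natseq mu) r)%N) (sh T == mu).
  move=> rT; apply: (iffP eqP) => [<- r c|muE]; first exact: entry_sh.
  apply/val_inj/(inj_map val_inj)/(@eq_from_nth _ 0%N) => [|r _].
    rewrite [LHS]size_map [RHS]size_map.
    exact: (etrans (size_tuple (sh T)) (esym (size_tuple mu))).
  by apply: eq_ltn_inj => c; exact: (etrans (esym (entry_sh T r c rT)) (muE r c)).
rewrite /dual_groth (partition_big sh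
  (fun mu => is_part (natseq mu) && all2 leq (natseq mu) la)) /=; last first.
  (* The shape is a partition because columns increase, and lies inside [la] because outside [la]
     the entry is [N.+1]. *)
  move=> T rT; have [_ col] := is_rppP pla T rT; apply/andP; split.
    apply/(sortedP 0%N) => r _; rewrite /= leqNgt -entry_sh // -leqNgt.
    rewrite leqNgt; apply/negP => lt; have := col _ _ (nth 0 (natseq (sh T)) r)%N (leqnSn r).
    by rewrite leqNgt (leq_trans lt) // leqNgt entry_sh // ltnn.
  apply: all2_leq_nth => [|r]; first by rewrite size_map; apply: (size_tuple (sh T)).
  by rewrite leqNgt -entry_sh // entry_out // ltnNge leqnSn.
apply: eq_bigr => mu /andP[pmu mula].
transitivity (\sum_(T in @extend la (natseq mu) N @: [set T | is_rpp T])
    (\prod_(r < size la) t`_r ^+ nrepeats T r) *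
    (\prod_(i < N.+1) tnth [tuple of rcons x a] i ^+ ncols_with T i)).
  apply: eq_bigl => T; apply/andP/imsetP => [[rT /(shP _ _ rT) muE]|].
    have [T' rT' ->] := (extend_image pla pmu mula T).1 (conj rT muE).
    by exists T'; rewrite ?inE.
  move=> [T']; rewrite inE => rT' TE.
  have [rT muE] := (extend_image pla pmu mula T).2 (ex_intro2 _ _ T' rT' TE).
  by split=> //; apply/(shP _ _ rT).
rewrite big_imset /=; last by move=> ? ? _ _; apply: extend_inj.
rewrite mulr_sumr; apply: eq_big => [T|T _]; first by rewrite inE.
rewrite big_ord_recr /= (ncols_extend_max pla pmu mula lam).
have -> : tnth [tuple of rcons x a] ord_max = a.
  by rewrite (tnth_nth 0) /= nth_rcons size_tuple ltnn eqxx.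
rewrite -(big_mkord xpredT (fun r => t`_r ^+ nrepeats T r)) (sub_size mula) big_mkord.
under eq_bigr => r _ do rewrite (nrepeats_extend pla pmu mula lam) exprD.
under [X in _ * (X * _)]eq_bigr => i _.
  rewrite (ncols_extend_lt pla pmu mula lam).
  have -> : tnth [tuple of rcons x a] (widen_ord (leqnSn N) i) = tnth x i.
    by rewrite !(tnth_nth 0) /= nth_rcons size_tuple ltn_ord.
  over.
rewrite /branch_weight /bfactor !big_split /= -prodrXr.
by rewrite -!mulrA; ring.
Qed.

Lemma part_head0 la i : is_part la -> head 0%N la = 0%N -> nth 0%N la i = 0%N.
Proof. by move=> pla h0; apply/eqP; rewrite -leqn0 -[X in (_ <= X)%N]h0 part_head. Qed.

Lemma tuple_rcons (T : Type) N (x : N.+1.-tuple T) :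
  exists a (y : N.-tuple T), x = [tuple of rcons y a].
Proof.
case/tupleP E: (rev_tuple x) => [a y]; exists a, (rev_tuple y).
by apply: val_inj; rewrite /= -rev_cons -[LHS]revK; congr rev; apply: (congr1 val E).
Qed.

(** * The Jacobi-Trudi formula and the symmetry in [x] *)

Section JacobiTrudi.
Variables (R : comNzRingType) (t : seq R).

Lemma jt_rows_perm l (x1 x2 : seq R) r la : perm_eq x1 x2 ->
  jt_rows t l x1 r la = jt_rows t l x2 r la.
Proof.
move=> xx; elim: la r => //= p la IHla r.
by rewrite IHla (hrow_perm _ _ (perm_flag t r xx)).
Qed.

Lemma size_jt_rows l x r la : size (jt_rows t l x r la) = size la.
Proof. by elim: la r => //= p la IHla r; rewrite IHla. Qed.

Lemma nth_jt_rows l x r la i : (i < size la)%N ->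
  nth 0 (jt_rows t l x r la) i =
  hrow l (flag t x (r + i)) (nth 0%N la i + (size la - i)).
Proof.
elim: la r i => [//|p la IHla] r [|i] /=; first by rewrite addn0 subn0.
by move=> il; rewrite IHla // addSnnS.
Qed.

Lemma rowdet_jt_rows x la : rowdet (jt_rows t (size la) x 0 la) =
  \det (\matrix_(i < size la)
          hrow (size la) (flag t x i) (nth 0%N la i + (size la - i))).
Proof.
rewrite /rowdet size_jt_rows eqxx; congr (\det _); apply/row_matrixP => i.
by rewrite !rowK nth_jt_rows.
Qed.

(** If all parts are 0, entry (i, j) is h_(j - i) and the matrix is unitriangular. Otherwise the top
    row, which has no variables, consists of h of positive degree and vanishes. *)
Lemma rowdet_jt_nil la : is_part la ->
  rowdet (jt_rows t (size la) [::] 0 la) = (head 0%N la == 0%N)%:R.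
Proof.
move=> pla; have [h0|hn0] := eqVneq (head 0%N la) 0%N.
  rewrite rowdet_jt_rows; set A := \matrix_i _.
  have AE i j : A i j = hsym (size la) (flag t [::] i) ((size la - i) + j)%N.
    by rewrite !mxE (part_head0 i pla h0).
  rewrite -det_tr det_trig; last first.
    by apply/is_trig_mxP => i j ij; rewrite mxE AE hsym_lt //; have := ltn_ord j; lia.
  by apply: big1 => i _; rewrite mxE AE subnK ?hsym_deg0 // ltnW.
case: la hn0 {pla} => [//|p la] /= p0.
set r0 := hrow _ _ _; suff -> : r0 = 0 by apply: (rowdet_zero [::]).
apply/rowP => j; rewrite !mxE /flag /=.
by rewrite (_ : (_ == _) = false) //; apply/eqP; move: p0; lia.
Qed.

Lemma dual_groth_nil la (x : 0.-tuple R) : is_part la ->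
  dual_groth la x t = (head 0%N la == 0%N)%:R.
Proof.
move=> pla; have [h0|hn0] := eqVneq (head 0%N la) 0%N.
  have nobox (b : box la) : False by case: b => -[r [c ch]] /= _; rewrite h0 in ch.
  rewrite /dual_groth (eq_big xpredT (fun _ => 1)).
  - rewrite sumr_const card_ffun card_ord.
    by rewrite eq_card0 // => b; case: (nobox b).
  - move=> T; rewrite /is_rpp /row_weak /col_weak.
    by apply/andP; split; apply/forallP => b; case: (nobox b).
  - move=> T _; rewrite big_ord0 mulr1 big1 // => r _.
    by rewrite /nrepeats eq_card0 // => b; case: (nobox b).
have [b _] : exists b : box la, box_row b = 0%N :> nat /\ box_col b = 0%N :> nat.
  by apply: box_exists => //; rewrite nth0 lt0n.
by rewrite /dual_groth big1 // => T; case: (T b).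
Qed.

(** One recursion removes the last variable and the other the first; the symmetry of the determinant
    in [x] reconciles them. *)
Lemma dual_groth_jt la N (x : N.-tuple R) : is_part la ->
  dual_groth la x t = rowdet (jt_rows t (size la) x 0 la).
Proof.
elim: N la x => [|N IHN] la x pla.
  by rewrite dual_groth_nil // tuple0 rowdet_jt_nil.
have [a [y ->]] := tuple_rcons x.
have alla : all (leq^~ (head 0%N la)) la.
  by apply/(all_nthP 0%N) => i _; apply: part_head.
rewrite (dual_groth_rcons _ _ _ pla alla erefl).
have ya : perm_eq (rcons y a) (a :: y) by rewrite perm_rcons.
rewrite (jt_rows_perm _ _ _ ya) (rowdet_branch t [::] a y 0 pla alla).
apply: eq_bigr => mu /andP[pmu _]; rewrite IHN //.
by rewrite size_map size_tuple.
Qed.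

Lemma dual_groth_perm la N1 N2 (x1 : N1.-tuple R) (x2 : N2.-tuple R) :
  is_part la -> perm_eq x1 x2 -> dual_groth la x1 t = dual_groth la x2 t.
Proof. by move=> pla xx; rewrite !dual_groth_jt // (jt_rows_perm _ _ _ xx). Qed.

End JacobiTrudi.

(** * Schur polynomials and the rectangle *)

Section Schur.
Variables (la : seq nat) (pla : is_part la).

(** In a reverse plane partition, two equal entries of a column force equality in between, hence a
    repeat directly below the upper one. *)
Lemma ssyt_rpp N (T : {ffun box la -> 'I_N}) :
  is_ssyt T = is_rpp T && [forall r : 'I_(size la), nrepeats T r == 0%N].
Proof.
apply/andP/andP => [[row col]|[rT rep0]].
  have col_lt b b' : box_col b = box_col b' -> (box_row b < box_row b')%N ->
      (T b < T b')%N.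
    move=> cc rr; apply: (implyP (forallP (forallP col b) b')).
    by rewrite cc eqxx.
  split.
    rewrite /is_rpp row; apply/forallP => b; apply/forallP => b'.
    apply/implyP => /andP[/eqP cc]; rewrite leq_eqVlt => /orP[/eqP rr|rr].
      by rewrite (box_inj rr (congr1 val cc)).
    by rewrite ltnW // col_lt.
  apply/forallP => r; rewrite cards_eq0; apply/eqP/setP => b; rewrite !inE.
  apply/negP => /andP[/eqP rb /existsP[b' /and3P[/eqP rb' /eqP cc /eqP TT]]].
  by have := col_lt b b' (esym cc); rewrite TT rb rb' ltnn ltnSn => /(_ isT).
case/andP: (rT) => -> _; split=> //; have [_ col] := is_rppP pla T rT.
apply/forallP => b; apply/forallP => b'; apply/implyP => /andP[/eqP cc rr].
rewrite ltnNge; apply/negP => Tb'b.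
have rep := forallP rep0 (box_row b).
rewrite (nrepeatsE pla (leqnn _)) cards_eq0 in rep.
have /setP/(_ (box_col b)) := eqP rep; rewrite !inE => /negP; apply.
have -> : (box_col b < nth 0%N la (box_row b).+1)%N.
  by rewrite cc (leq_trans (box_in b') (part_nth pla rr)).
by rewrite eqn_leq col //= entry_box (leq_trans _ Tb'b) // -entry_box cc col.
Qed.

(** For the empty [t] every t_r is 0, which kills the fillings with a repeat. In the others a column
    contains a letter at most once, so columns and boxes with a given letter are equally many. *)
Lemma schur_dual_groth (R : comNzRingType) N (x : N.-tuple R) :
  schur la x = dual_groth la x [::].
Proof.
rewrite /schur /dual_groth big_mkcond [RHS]big_mkcond; apply: eq_bigr => T _.
rewrite ssyt_rpp; case: ifP => [/andP[rT rep0]|]; last first.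
  case: ifP => // _ /negbT/forallPn[r nrep].
  rewrite (bigD1 r) //= nth_nil expr0n (negPf nrep) !mul0r //.
rewrite rT [X in _ = X * _]big1 ?mul1r => [|r _]; last by rewrite (eqP (forallP rep0 r)).
have /andP[_ col] : is_ssyt T by rewrite ssyt_rpp rT.
rewrite (partition_big T xpredT) //=; apply: eq_bigr => i _.
rewrite (eq_bigr (fun _ => tnth x i)) => [|b /eqP-> //].
rewrite prodr_const; congr (_ ^+ _).
rewrite /ncols_with -(card_in_imset (f := fun b : box la => box_col b)
  (D := [pred b | T b == i])).
  apply: eq_card => c; rewrite inE; apply/imsetP/existsP => [[b Tb ->]|[b /andP[/eqP<- Tb]]].
    by exists b; rewrite eqxx.
  by exists b.
move=> b b' /eqP Tb /eqP Tb' cc; case: (ltngtP (box_row b) (box_row b')) => rr.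
- have := implyP (forallP (forallP col b) b').
  by rewrite cc eqxx rr Tb Tb' ltnn => /(_ isT).
- have := implyP (forallP (forallP col b') b).
  by rewrite cc eqxx rr Tb Tb' ltnn => /(_ isT).
- by apply: box_inj => //; rewrite cc.
Qed.

End Schur.

(* For a rectangle the flags do not matter: subtracting [t_k] times row [i+1]
   from row [i] removes the variable [t_k] from row [i]. *)
Lemma rectangle_flags (R : comNzRingType) (t z : seq R) l m : (0 < l)%N ->
  rowdet (jt_rows t l z 0 (nseq l m)) =
  \det (\matrix_(i < l) hrow l (flag t z l.-1) (m + (l - i))).
Proof.
(* [A 0] is the Jacobi-Trudi matrix and [A l.-1] has one flag in all rows; from [A k] to [A k.+1]
   the rows 0 to k change, by a unitriangular factor. *)
move=> l0; pose A k := \matrix_(i < l) hrow l (flag t z (maxn i k)) (m + (l - i)).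
have stepA k : (k.+1 < l)%N -> \det (A k) = \det (A k.+1).
  move=> kl.
  pose P : 'M[R]_l := \matrix_(i, j) ((j == i.+1 :> nat) && (i <= k)%N)%:R.
  have -> : A k = (1%:M - t`_k *: P) *m A k.+1.
    apply/row_matrixP => i; apply/rowP => c.
    rewrite mulmxBl mul1mx -scalemxAl !mxE.
    case: (leqP i k) => ik; last first.
      rewrite big1 ?mulr0 ?subr0 => [|j _]; last by rewrite mxE (leqNgt i) ik andbF mul0r.
      by rewrite (maxn_idPl ik).
    have il : (i.+1 < l)%N by rewrite (leq_ltn_trans _ kl).
    rewrite (bigD1 (Ordinal il)) //= big1 ?addr0 => [|j]; last first.
      by rewrite -val_eqE /= mxE => /negPf->; rewrite mul0r.
    rewrite !mxE /= eqxx ik mul1r (maxn_idPr (leqW ik)).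
    rewrite (maxn_idPr (_ : i.+1 <= k.+1)%N) // flagS.
    have -> : (m + (l - i))%N = (m + (l - i.+1)).+1 by lia.
    by rewrite /= addrK.
  rewrite det_mulmx -[\det (1%:M - _)]det_tr det_trig; last first.
    apply/is_trig_mxP => i j ij; rewrite !mxE.
    have -> : (j == i) = false by apply/eqP => ji; rewrite ji ltnn in ij.
    by rewrite (_ : (i == j.+1 :> nat) = false) ?mulr0 ?subr0 //; apply/eqP; lia.
  rewrite big1 ?mul1r // => i _; rewrite !mxE eqxx.
  by rewrite (_ : (i == i.+1 :> nat) = false) ?mulr0 ?subr0 //; apply/eqP; lia.
have detA k : (k < l)%N -> \det (A 0%N) = \det (A k).
  by elim: k => [//|k IHk] kl; apply: etrans (IHk (ltnW kl)) (stepA k kl).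
have := rowdet_jt_rows t z (nseq l m); rewrite size_nseq => ->.
transitivity (\det (A 0%N)); first congr (\det _); last first.
  rewrite (detA l.-1) ?prednK //; congr (\det _); apply/row_matrixP => i.
  by rewrite !rowK (maxn_idPr _) // -ltnS prednK.
by apply/row_matrixP => i; rewrite !rowK maxn0 nth_nseq ltn_ord.
Qed.

Lemma is_part_nseq l m : is_part (nseq l m).
Proof. by rewrite /is_part; case: l => //= l; elim: l => //= l ->; rewrite leqnn. Qed.

(** After [rectangle_flags] each determinant has a constant flag: on the Schur side [w] preceded by
    zeros, which do not affect h, on the other a rearrangement of [t ++ z]. *)
Lemma schur_rectangle (R : comNzRingType) l m N1 N2
    (z : N1.-tuple R) (w : N2.-tuple R) (t : (l.-1).-tuple R) : (0 < l)%N ->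
  perm_eq w (t ++ z) -> schur (nseq l m) w = dual_groth (nseq l m) z t.
Proof.
move=> l0 wtz; have pR := is_part_nseq l m.
rewrite schur_dual_groth // !dual_groth_jt // size_nseq !rectangle_flags //.
congr (\det _); apply/row_matrixP => i; rewrite !rowK; apply/rowP => j.
rewrite !mxE; have -> : flag [::] w l.-1 = nseq l.-1 0 ++ w.
  rewrite /flag (_ : mkseq _ _ = nseq l.-1 0) ?rev_nseq //.
  apply: (@eq_from_nth _ 0) => [|k]; rewrite ?size_mkseq ?size_nseq // => kl.
  by rewrite nth_mkseq // nth_nseq kl nth_nil.
rewrite hsym_nseq0; apply: hsym_perm; rewrite (perm_trans wtz) //.
rewrite /flag -[in X in mkseq _ X](size_tuple t) mkseq_nth perm_cat2r.
by rewrite perm_sym perm_rev.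
Qed.

(* Both sides count the columns meeting [la / mu], by their lowest and by their
   highest box. *)
Lemma count_columns (la mu : nat -> nat) k :
  (forall r, mu r <= la r)%N ->
  (forall r, la r.+1 <= la r)%N -> (forall r, mu r.+1 <= mu r)%N ->
  (\sum_(r < k) (la r - maxn (la r.+1) (mu r)) + (la k - mu k) =
   (la 0 - mu 0) + \sum_(r < k) (minn (mu r) (la r.+1) - mu r.+1))%N.
Proof.
move=> mula pla pmu; elim: k => [|k IHk]; first by rewrite !big_ord0 addn0.
rewrite !big_ord_recr /=.
move: IHk (mula k) (mula k.+1) (pla k) (pmu k).
set S := (\sum_(i < k) (la i - _))%N; set S' := (\sum_(i < k) (minn _ _ - _))%N; lia.
Qed.

(** * Chains of shapes and complementation in the rectangle *)

Section Complement.
Variables l m : nat.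
Local Notation shape := (l.-tuple 'I_m.+1).
Implicit Types la mu nu : shape.

Definition compl la : shape := [tuple rev_ord (tnth la (rev_ord i)) | i < l].

Lemma nth_shape la (i : 'I_l) : nth 0%N (natseq la) i = tnth la i.
Proof. by rewrite (nth_map ord0) ?size_tuple // (tnth_nth ord0). Qed.

Lemma size_shape la : size (natseq la) = l.
Proof. by rewrite size_map size_tuple. Qed.

Lemma nth_shape_le la r : (nth 0 (natseq la) r <= m)%N.
Proof.
case: (ltnP r l) => rl; last by rewrite nth_default // size_shape.
by rewrite (nth_shape la (Ordinal rl)) -ltnS.
Qed.

Lemma nth_compl la r : (r < l)%N ->
  nth 0%N (natseq (compl la)) r = (m - nth 0 (natseq la) (l - r.+1))%N.
Proof.
move=> rl; rewrite (nth_shape _ (Ordinal rl)) tnth_mktuple /= subSS.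
by rewrite -(nth_shape la (rev_ord (Ordinal rl))).
Qed.

Lemma complK : involutive compl.
Proof. by move=> la; apply: eq_from_tnth => i; rewrite !tnth_mktuple !rev_ordK. Qed.

Lemma natseq_compl la : natseq (compl la) = box_compl m (natseq la).
Proof.
apply: (@eq_from_nth _ 0%N) => [|r].
  by rewrite size_shape /box_compl size_rev size_map size_shape.
rewrite size_shape => rl; rewrite nth_compl // /box_compl nth_rev size_map size_shape //.
by rewrite (nth_map 0%N) // size_shape ltn_subrL (leq_ltn_trans _ rl).
Qed.

Lemma is_part_compl la : is_part (natseq la) -> is_part (natseq (compl la)).
Proof.
move=> pla; apply/(sortedP 0%N) => r; rewrite size_shape => rl /=.
rewrite (nth_compl _ rl) (nth_compl _ (ltnW rl)).
by apply: leq_sub2l; apply: part_nth => //; lia.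
Qed.

Lemma sub_compl la mu : all2 leq (natseq mu) (natseq la) ->
  all2 leq (natseq (compl la)) (natseq (compl mu)).
Proof.
move=> mula; apply: all2_leq_nth => [|r]; first by rewrite !size_shape.
case: (ltnP r l) => rl; last by rewrite !nth_default ?size_shape.
by rewrite !nth_compl // leq_sub2l // sub_nth.
Qed.

(** Containment suffices, since one letter of a reverse plane partition may occupy any skew
    shape. *)
Definition strip mu la := [&& is_part (natseq mu), is_part (natseq la)
  & all2 leq (natseq mu) (natseq la)].

Lemma strip_compl mu la : strip (compl la) (compl mu) = strip mu la.
Proof.
suff impl mu' la' : strip mu' la' -> strip (compl la') (compl mu').
  by apply/idP/idP => /impl; rewrite ?complK.
by case/and3P => *; rewrite /strip !is_part_compl // sub_compl.
Qed.

Variables (R : comNzRingType).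
Implicit Types (t : seq R) (a : R).

Lemma branch_weight_split t a mu la :
  branch_weight t a 0 (natseq la) (natseq mu) =
  a ^+ (\sum_(i < l) (nth 0 (natseq la) i -
          maxn (nth 0 (natseq la) i.+1) (nth 0 (natseq mu) i)))%N *
  \prod_(i < l.-1) t`_i ^+ (nth 0 (natseq la) i.+1 - nth 0 (natseq mu) i)%N.
Proof.
rewrite /branch_weight /bfactor big_split /= prodrXr size_shape; congr (_ * _).
have := size_shape la; case: l la mu => [|k] la mu sz; first by rewrite !big_ord0.
by rewrite big_ord_recr /= [nth _ _ k.+1]nth_default ?sz // sub0n mulr1.
Qed.

(** Rotation by 180 degrees exchanges lowest and highest boxes of columns, which [count_columns]
    allows, and sends the rows (i, i + 1) to (l - 2 - i, l - 1 - i), whence [rev t]. *)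
Lemma branch_weight_compl t a mu la : size t = l.-1 -> strip mu la ->
  branch_weight (rev t) a 0 (natseq (compl mu)) (natseq (compl la)) =
  branch_weight t a 0 (natseq la) (natseq mu).
Proof.
move=> szt /and3P[pmu pla mula]; rewrite !branch_weight_split.
have mono s r : is_part s -> (nth 0 s r.+1 <= nth 0 s r)%N by move=> ps; apply: part_nth.
congr (_ ^+ _ * _).
  have [l0|l0] := posnP l.
    by rewrite !big1 // => -[i il]; exfalso; rewrite l0 in il.
  have sumr (F : nat -> nat) : (\sum_(i < l) F i = \sum_(i < l.-1) F i + F l.-1)%N.
    by case: (l) l0 => // k _; rewrite big_ord_recr.
  have suml (F : nat -> nat) : (\sum_(i < l) F i = F 0 + \sum_(i < l.-1) F i.+1)%N.
    by case: (l) l0 => // k _; rewrite big_ord_recl.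
  have last0 nu : nth 0%N (natseq nu) l.-1.+1 = 0%N.
    by rewrite nth_default // size_shape prednK.
  (* In the last row the maximum is mu_(l-1), and the summand is the boundary term of
     [count_columns]. *)
  rewrite [RHS](sumr (fun i => nth 0 (natseq la) i -
    maxn (nth 0 (natseq la) i.+1) (nth 0 (natseq mu) i))%N) last0 max0n.
  rewrite (count_columns l.-1 (sub_nth mula) (fun r => mono _ r pla) (fun r => mono _ r pmu)).
  rewrite (reindex_inj rev_ord_inj) /=.
  rewrite (suml (fun s => nth 0 (natseq (compl mu)) (l - s.+1) -
    maxn (nth 0 (natseq (compl mu)) (l - s.+1).+1) (nth 0 (natseq (compl la)) (l - s.+1)))%N).
  have bnd r := conj (nth_shape_le mu r) (conj (nth_shape_le la r) (sub_nth mula r)).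
  congr (_ + _)%N.
    by rewrite subn1 last0 max0n !nth_compl ?prednK // subnn; move: (bnd 0%N); lia.
  apply: eq_bigr => i _; have il := ltn_ord i.
  rewrite -subSn; last by lia.
  rewrite subSS !nth_compl; try lia.
  rewrite (_ : l - (l - i.+1).+1 = i)%N; last by lia.
  rewrite (_ : l - (l - i.+2).+1 = i.+1)%N; last by lia.
  move: (bnd i) (bnd i.+1); lia.
rewrite (reindex_inj rev_ord_inj) /=; apply: eq_bigr => i _.
have il := ltn_ord i.
rewrite nth_rev ?szt; last by lia.
rewrite !nth_compl; try lia.
rewrite (_ : l.-1 - (l.-1 - i.+1).+1 = i)%N; last by lia.
rewrite (_ : l - (l.-1 - i.+1).+2 = i)%N; last by lia.
rewrite (_ : l - (l.-1 - i.+1).+1 = i.+1)%N; last by lia.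
move: (nth_shape_le mu i) (nth_shape_le la i.+1) => h1 h2.
by congr (_ ^+ _); lia.
Qed.

(** The generating function of reverse plane partitions of shape la / mu, seen as chains of
    partitions from [mu] to [la]; the head of [s] belongs to the largest letter. *)
Fixpoint transfer t (s : seq R) mu la : R :=
  if s is a :: s' then
    \sum_(nu : shape | strip nu la)
       branch_weight t a 0 (natseq la) (natseq nu) * transfer t s' mu nu
  else (mu == la)%:R.

(** The same chains, cut at the innermost step instead of the outermost. *)
Lemma transfer_rcons t s a mu la : transfer t (rcons s a) mu la =
  \sum_(nu : shape | strip mu nu)
     branch_weight t a 0 (natseq nu) (natseq mu) * transfer t s nu la.
Proof.
elim: s la => [|b s IHs] la.
  rewrite /= [LHS]big_mkcond [RHS]big_mkcond /= (bigD1 mu) //= [RHS](bigD1 la) //=.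
  rewrite !eqxx !big1 // => nu /negPf; last by rewrite eq_sym => ->; rewrite mulr0 if_same.
  by move=> ->; rewrite mulr0 if_same.
rewrite /=; under eq_bigr => nu _ do rewrite IHs mulr_sumr.
rewrite exchange_big /=; apply: eq_bigr => rho _; rewrite mulr_sumr.
by apply: eq_bigr => nu _; rewrite mulrCA.
Qed.

(** Complementation reverses inclusions, hence the chains and the order of the letters. *)
Lemma transfer_compl t s mu la : size t = l.-1 ->
  transfer (rev t) s (compl la) (compl mu) = transfer t (rev s) mu la.
Proof.
move=> szt; elim: s mu => [|a s IHs] mu.
  by rewrite /= (inv_eq complK) complK eq_sym.
rewrite rev_cons transfer_rcons /= (reindex_inj (inv_inj complK)) /=.
apply: eq_big => [nu|nu]; rewrite strip_compl // => st.
by rewrite branch_weight_compl // IHs.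
Qed.

(** Induction on [y] from its end: each step removes the largest letter, which is why [transfer]
    reads [rev y]. *)
Lemma dual_groth_cat t la (N1 N2 : nat) (x : N1.-tuple R) (y : N2.-tuple R) :
  is_part (natseq la) ->
  dual_groth (natseq la) [tuple of x ++ y] t =
  \sum_(nu : shape | is_part (natseq nu))
     dual_groth (natseq nu) x t * transfer t (rev y) nu la.
Proof.
elim: N2 y la => [|N2 IHN] y la pla.
  transitivity (dual_groth (natseq la) x t).
    by apply: dual_groth_perm; rewrite //= tuple0 cats0.
  rewrite tuple0 (bigD1 la) //= eqxx mulr1 big1 ?addr0 // => nu /andP[_ /negPf->].
  by rewrite mulr0.
have [a [z ->]] := tuple_rcons y.
rewrite (dual_groth_perm _ (x2 := [tuple of rcons (x ++ z) a])) //=; last by rewrite rcons_cat.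
have alla : all (leq^~ m) (natseq la).
  by apply/(all_nthP 0%N) => i _; apply: nth_shape_le.
rewrite (dual_groth_rcons _ _ _ pla alla (size_shape la)) rev_rcons /=.
under [RHS]eq_bigr => nu _ do rewrite mulr_sumr.
rewrite exchange_big /=; apply: eq_big => [mu|mu /andP[pmu mula]].
  by rewrite /strip pla.
by rewrite IHN // mulr_sumr; apply: eq_bigr => nu _; rewrite mulrCA.
Qed.

Definition empty_shape : shape := [tuple ord0 | i < l].

Lemma nth_empty_shape r : nth 0%N (natseq empty_shape) r = 0%N.
Proof.
case: (ltnP r l) => rl; last by rewrite nth_default // size_shape.
by rewrite (nth_shape _ (Ordinal rl)) tnth_mktuple.
Qed.

(** This is [dual_groth_cat] without [x], where only the empty shape survives; symmetry undoes the
    reversal of [y]. *)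
Lemma transfer0 t (N : nat) (y : N.-tuple R) mu :
  is_part (natseq mu) ->
  transfer t y empty_shape mu = dual_groth (natseq mu) y t.
Proof.
move=> pmu; have p0 : is_part (natseq empty_shape).
  by apply/(sortedP 0%N) => r _; rewrite !nth_empty_shape.
have := dual_groth_cat t [tuple] (rev_tuple y) pmu.
rewrite (bigD1 empty_shape) //= big1 ?addr0 => [|nu /andP[pnu nu0]]; last first.
  rewrite dual_groth_nil // (_ : (_ == _) = false) ?mul0r //.
  apply: contraNF nu0 => /eqP h0; apply/eqP/eq_from_tnth => i.
  by apply: val_inj; rewrite tnth_mktuple /= -nth_shape part_head0.
have h0 : head 0%N (natseq empty_shape) == 0%N by rewrite -nth0 nth_empty_shape.
rewrite revK dual_groth_nil // h0 mul1r => <-; apply: dual_groth_perm => //=.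
by rewrite perm_rev.
Qed.

(** The complement of the full rectangle is empty, so the factor of shape m^l / la becomes a
    [transfer] from the empty shape. *)
Lemma dual_groth_rectangle_cat t N1 N2 (x : N1.-tuple R) (y : N2.-tuple R) :
  size t = l.-1 ->
  dual_groth (nseq l m) [tuple of x ++ y] t =
  \sum_(la : shape | is_part (natseq la))
    dual_groth (natseq la) x t *
    dual_groth (box_compl m (natseq la)) y (rev t).
Proof.
move=> szt; pose full : shape := [tuple ord_max | i < l].
have fullE : nseq l m = natseq full.
  apply: (@eq_from_nth _ 0%N) => [|r]; rewrite size_nseq ?size_shape // => rl.
  by rewrite nth_nseq rl (nth_shape _ (Ordinal rl)) tnth_mktuple.
have compl_full : compl full = empty_shape.
  by apply: eq_from_tnth => i; rewrite !tnth_mktuple; apply: val_inj; rewrite /= subnn.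
rewrite fullE dual_groth_cat -?fullE ?is_part_nseq //.
apply: eq_bigr => la pla; congr (_ * _).
by rewrite -transfer_compl // compl_full transfer0 ?is_part_compl // natseq_compl.
Qed.

End Complement.

Theorem corollary3p12 (R : comNzRingType) (l m n : nat) (hl : (1 <= l)%N) :
  let P : comNzRingType := {mpoly R[n + (l.-1 + n)]} in
  let x : n.-tuple P := [tuple 'X_(lshift (l.-1 + n) i) | i < n] in
  let t : (l.-1).-tuple P := [tuple 'X_(rshift n (lshift n j)) | j < l.-1] in
  let y : n.-tuple P := [tuple 'X_(rshift n (rshift l.-1 i)) | i < n] in
  schur (nseq l m) [tuple of x ++ t ++ y] =
  \sum_(la : l.-tuple 'I_m.+1 | is_part [seq nat_of_ord k | k <- la])
    dual_groth [seq nat_of_ord k | k <- la] x t *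
    dual_groth (box_compl m [seq nat_of_ord k | k <- la]) y (rev t).
Proof.
move=> P x t y.
rewrite (@schur_rectangle P l m _ _ [tuple of x ++ y] _ t) //=; last by rewrite perm_catCA.
by rewrite (dual_groth_rectangle_cat _ _ _ (size_tuple t)).
Qed.
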